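(* Let $\kappa$ be an infinite regular cardinal, $\nu\le\kappa$ an infinite cardinal, and $\theta$ a cardinal with $2\le\theta\le\kappa$. Suppose that $\mathrm{unbounded}(\{\nu\},J^{\mathrm{bd}}[\kappa],\theta)$ holds. Then: (1) $\theta\le\kappa$, and if $\nu<\mathrm{cf}(\theta)$, then $\theta=\kappa$; (2) $\mathrm{cf}(\theta)\le\nu^+$; (3) $\kappa\le2^\nu$.
   Context: $J^{\mathrm{bd}}[\kappa]$ is the ideal of bounded subsets of $\kappa$. $[\kappa]^2$ is identified with the set of pairs $(\alpha,\beta)$ with $\alpha<\beta<\kappa$. A colouring $c:[\kappa]^2\to\theta$ is upper-regressive if $c(\alpha,\beta)<\beta$ for all $\alpha<\beta<\kappa$. $\mathrm{unbounded}(\{\nu\},J^{\mathrm{bd}}[\kappa],\theta)$ asserts that there is an upper-regressive colouring $c:[\kappa]^2\to\theta$ such that for every unbounded $B\subseteq\kappa$ there is $\eta<\nu$ such that $\mathrm{otp}(\{c(\eta,\beta)\mid\beta\in B,\ \beta>\eta\})=\theta$. *)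

(* Defs.v *)
From HB Require Import structures.
From mathcomp Require Import all_boot all_order.
From mathcomp Require Import boolp wochoice classical_sets functions cardinality.

Set Implicit Arguments.
Unset Strict Implicit.
Unset Printing Implicit Defensive.

Import Order.TTheory.
Local Open Scope classical_set_scope.
Local Open Scope card_scope.
Local Open Scope quotient_scope.
Local Open Scope order_scope.

Record wo := Wo {
  wo_sort :> Type;
  wo_le : rel wo_sort;
  wo_leP : well_order wo_le }.

HB.instance Definition _ := gen_eqMixin wo.
HB.instance Definition _ := gen_choiceMixin wo.

Section WoTheory.
Variable W : wo.
Implicit Types x y z : W.

Lemma wo_min (P : W -> Prop) : (exists x, P x) ->
  exists2 z, P z & forall x, P x -> wo_le z x.
Proof.
move=> [x Px]; have [|z [[Pz zmin] _]] := wo_leP (A := fun x => `[< P x >]).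
  by exists x; apply/asboolP.
by exists z => [|y Py]; [exact/asboolP | exact/zmin/asboolP].
Qed.

Lemma wo_total x y : wo_le x y || wo_le y x.
Proof.
have [|z [->|->] zmin] := @wo_min (fun z => z = x \/ z = y).
- by exists x; left.
- by rewrite zmin //; right.
- by rewrite (zmin x) ?orbT //; left.
Qed.

Lemma wo_refl x : wo_le x x.
Proof. by have := wo_total x x; rewrite orbb. Qed.

Lemma wo_anti x y : wo_le x y -> wo_le y x -> x = y.
Proof.
move=> xy yx; have [|z [_ zuniq]] := wo_leP (A := fun z => `[< z = x \/ z = y >]).
  by exists x; apply/asboolP; left.
rewrite -(zuniq x) ?(zuniq y) //; split; do ?[by apply/asboolP; auto];
  by move=> _ /asboolP[|] ->; rewrite ?wo_refl.
Qed.

Lemma wo_trans x y z : wo_le x y -> wo_le y z -> wo_le x z.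
Proof.
move=> xy yz.
have [|t tP tmin] := @wo_min (fun t => [\/ t = x, t = y | t = z]).
  by exists x; constructor 1.
case: tP tmin => -> tmin.
- by apply: tmin; constructor 3.
- by rewrite (wo_anti xy (tmin x _)) //; constructor 1.
- by rewrite -(wo_anti yz (tmin y _)) //; constructor 2.
Qed.

Lemma wo_ltW x y : ~~ wo_le y x -> wo_le x y.
Proof. by have := wo_total x y; case: (wo_le y x); rewrite ?orbF. Qed.

Lemma wo_lt_le x y z : ~~ wo_le y x -> wo_le y z -> ~~ wo_le z x.
Proof. by move=> /negP yx yz; apply/negP => /(wo_trans yz). Qed.

Lemma wo_wf : well_founded (fun x y => ~~ wo_le y x).
Proof.
move=> x; apply: contrapT => nx.
have [|z nz zmin] := @wo_min (fun x => ~ Acc (fun x y => ~~ wo_le y x) x).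
  by exists x.
apply: nz; constructor => y /negP zy; apply: contrapT => ny.
exact/zy/zmin.
Qed.

Lemma wo_seg_subproof x :
  well_order (fun y z : {y | ~~ wo_le x y} => wo_le (val y) (val z)).
Proof.
move=> A [a Aa].
have [|z [y Ay ->] zmin] := @wo_min (fun y => exists2 z, z \in A & y = val z).
  by exists (val a); exists a.
exists y; split=> [|y' [Ay' y'min]]; first by split=> // z' Az'; apply: zmin; exists z'.
by apply/val_inj/wo_anti; [apply: zmin; exists y' | exact: y'min].
Qed.

Definition wo_seg x := Wo (@wo_seg_subproof x).

End WoTheory.

Definition wo_iso (V W : wo) :=
  `[< exists2 f : V -> W, bijective f & {mono f : x y / wo_le x y} >].

Definition wo_init (V W : wo) (f : V -> W) :=
  {mono f : x y / wo_le x y} /\ forall x y, wo_le y (f x) -> exists x', f x' = y.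

Lemma wo_iso_refl : reflexive wo_iso.
Proof. by move=> V; apply/asboolP; exists id; first by exists id. Qed.

Lemma wo_iso_sym : symmetric wo_iso.
Proof.
suff H V W : wo_iso V W -> wo_iso W V by move=> V W; apply/idP/idP; exact: H.
move=> /asboolP[f [g fK gK] fm]; apply/asboolP; exists g; first by exists f.
by move=> x y; rewrite -fm !gK.
Qed.

Lemma wo_iso_trans : transitive wo_iso.
Proof.
move=> W V U /asboolP[f fb fm] /asboolP[g gb gm].
by apply/asboolP; exists (g \o f); [exact: bij_comp | move=> x y /=; rewrite gm].
Qed.

Canonical wo_iso_equiv := EquivRel wo_iso wo_iso_refl wo_iso_sym wo_iso_trans.

Definition Ord := {eq_quot wo_iso}.
HB.instance Definition _ := Choice.on Ord.

Definition otype (W : wo) : Ord := \pi_Ord W.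

(** [a <= b] when [a] is isomorphic to an initial segment of [b]. *)
Definition ord_le (a b : Ord) : bool :=
  `[< exists f : repr a -> repr b, wo_init f >].

Lemma wo_init_comp (U V W : wo) (f : U -> V) (g : V -> W) :
  wo_init f -> wo_init g -> wo_init (g \o f).
Proof.
move=> [fm fi] [gm gi]; split=> [x y|x z /=]; first by rewrite /= gm fm.
move=> /[dup] /gi [y <-]; rewrite gm => /fi [x' <-].
by exists x'.
Qed.

Lemma wo_iso_init (V W : wo) : wo_iso V W -> exists f : V -> W, wo_init f.
Proof.
by move=> /asboolP[f [g _ gK] fm]; exists f; split=> // x y _; exists (g y).
Qed.

Lemma wo_iso_surj (V W : wo) (f : V -> W) :
  {mono f : x y / wo_le x y} -> (forall y, exists x, f x = y) -> wo_iso V W.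
Proof.
move=> fm fsurj; apply/asboolP; exists f => //.
pose h y := projT1 (cid (fsurj y)).
have hK : cancel h f by move=> y; rewrite /h; case: cid.
by exists h => // x; apply: wo_anti; rewrite -fm hK wo_refl.
Qed.

Lemma wo_mono_ge (W : wo) (f : W -> W) x :
  {mono f : x y / wo_le x y} -> wo_le x (f x).
Proof.
move=> fm; apply: contrapT => /negP nx.
have [|z zlt zmin] := @wo_min W (fun x => ~~ wo_le x (f x)); first by exists x.
by have /negP := zlt; apply; apply: zmin; rewrite fm.
Qed.

Lemma wo_init_anti (V W : wo) (f : V -> W) (g : W -> V) :
  wo_init f -> wo_init g -> wo_iso V W.
Proof.
move=> [fm fi] [gm gi]; apply: (wo_iso_surj fm) => y; apply: (fi (g y)).
by apply: (@wo_mono_ge W (f \o g)) => x z /=; rewrite fm.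
Qed.

Lemma wo_init_total (V W : wo) :
  (exists f : V -> W, wo_init f) \/ (exists g : W -> V, wo_init g).
Proof.
(* [f x] is the least element of [W] outside [f @` {y | y < x}], if any. *)
pose fresh x (rec : forall y : V, ~~ wo_le x y -> option W) (w : W) :=
  (forall y (h : ~~ wo_le x y), rec y h <> Some w).
pose F x rec : option W :=
  if pselect (exists w, fresh x rec w) is left h
  then Some (projT1 (cid2 (wo_min h))) else None.
pose f : V -> option W := Fix (@wo_wf V) _ F.
have fE x : f x = F x (fun y _ => f y).
  rewrite /f Fix_eq // => {}x g g' gg'; suff -> : g = g' by [].
  by apply: functional_extensionality_dep => y; exact: functional_extensionality_dep.
have fN x : f x = None -> forall w, exists2 y, ~~ wo_le x y & f y = Some w.
  rewrite fE /F; case: pselect => // nex _ w; apply: contrapT => nw.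
  by apply: nex; exists w => y h fy; apply: nw; exists y.
have fS x w : f x = Some w -> (forall y, ~~ wo_le x y -> f y <> Some w) /\
    (forall w', (forall y, ~~ wo_le x y -> f y <> Some w') -> wo_le w w').
  by rewrite fE /F; case: pselect => // ex [<-]; case: cid2.
have flt x y w w' : f x = Some w -> f y = Some w' -> ~~ wo_le y x -> ~~ wo_le w' w.
  move=> fx fy xy; apply/negP => w'w.
  have ww' : wo_le w w'.
    have [_] := fS _ _ fx; apply=> z zx; have [+ _] := fS _ _ fy; apply.
    exact: wo_lt_le zx (wo_ltW xy).
  have [/(_ x xy) + _] := fS _ _ fy; apply.
  by rewrite fx (wo_anti ww' w'w).
have fle x y w w' : f x = Some w -> f y = Some w' -> wo_le w w' = wo_le x y.
  move=> fx fy; apply/idP/idP => [ww'|]; last first.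
    have [xy yx|xy _] := boolP (wo_le y x).
      by have e := wo_anti yx xy; rewrite -e fx in fy; case: fy => ->; rewrite wo_refl.
    by apply: wo_ltW; exact: flt fx fy _.
  by apply: contrapT => /negP /(flt _ _ _ _ fy fx) /negP; apply.
have [tot|ntot] := pselect (forall x, f x <> None); [left|right].
  have fsome x : exists w, f x = Some w.
    by case e: (f x) => [w|]; [exists w | have := tot x].
  pose g x := projT1 (cid (fsome x)).
  have gP x : f x = Some (g x) by rewrite /g; case: cid.
  exists g; split=> [x y|x w wg]; first exact: fle.
  apply: contrapT => nw; apply: (nw); exists x; apply: wo_anti wg.
  have [_] := fS _ _ (gP x); apply=> y yx fy; apply: nw; exists y.
  by have := gP y; rewrite fy => -[].
have [x0 /contrapT fx0] := (existsNP _).2 ntot.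
have hex w : exists y, f y = Some w by have [y _ ?] := fN _ fx0 w; exists y.
pose h w := projT1 (cid (hex w)).
have hP w : f (h w) = Some w by rewrite /h; case: cid.
exists h; split=> [w w'|w x xh]; first by rewrite (fle _ _ _ _ (hP w) (hP w')).
have inj y w' : f y = Some w' -> y = h w'.
  move=> fy; apply: wo_anti.
    by rewrite -(fle _ _ _ _ fy (hP w')) wo_refl.
  by rewrite -(fle _ _ _ _ (hP w') fy) wo_refl.
case fx: (f x) => [w'|]; first by exists w'; rewrite -(inj _ _ fx).
have [y yx /inj yE] := fN _ fx w.
by move: yx; rewrite yE xh.
Qed.

Lemma repr_otype W : wo_iso (repr (otype W)) W.
Proof. by rewrite -[wo_iso _ _]/(wo_iso_equiv _ _) -eqmodE reprK. Qed.

Lemma otype_repr a : otype (repr a) = a.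
Proof. by rewrite /otype reprK. Qed.

Lemma otype_eq V W : wo_iso V W -> otype V = otype W.
Proof. by move=> VW; apply/eqmodP. Qed.

Lemma ord_leP V W :
  ord_le (otype V) (otype W) <-> exists f : V -> W, wo_init f.
Proof.
have [i ii] := wo_iso_init (repr_otype V).
have [j ji] := wo_iso_init (repr_otype W).
have [i' i'i] : exists f : V -> repr (otype V), wo_init f.
  by apply: wo_iso_init; rewrite wo_iso_sym repr_otype.
have [j' j'i] : exists f : W -> repr (otype W), wo_init f.
  by apply: wo_iso_init; rewrite wo_iso_sym repr_otype.
split=> [/asboolP[f fi]|[f fi]].
  by exists (j \o f \o i'); exact: (wo_init_comp i'i (wo_init_comp fi ji)).
apply/asboolP; exists (j' \o f \o i).
exact: (wo_init_comp ii (wo_init_comp fi j'i)).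
Qed.

Lemma ord_le_refl : reflexive ord_le.
Proof. by move=> a; apply/asboolP; exists id; split=> // x y; exists y. Qed.

Lemma ord_le_anti : antisymmetric ord_le.
Proof.
move=> a b /andP[/asboolP[f fi] /asboolP[g gi]].
by rewrite -(otype_repr a) -(otype_repr b); apply/otype_eq/(wo_init_anti fi gi).
Qed.

Lemma ord_le_trans : transitive ord_le.
Proof.
move=> b a c /asboolP[f fi] /asboolP[g gi].
by apply/asboolP; exists (g \o f); exact: wo_init_comp.
Qed.

Lemma ord_le_total : total ord_le.
Proof.
move=> a b; apply/orP.
by have [?|?] := wo_init_total (repr a) (repr b); [left|right]; apply/asboolP.
Qed.

HB.instance Definition _ := Order.Le_isPOrder.Build (Order.Disp tt tt) Ord
  ord_le_refl ord_le_anti ord_le_trans.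
HB.instance Definition _ := Order.POrder_isTotal.Build (Order.Disp tt tt) Ord
  ord_le_total.

Lemma lt_otypeP (a : Ord) W :
  a < otype W <-> exists x : W, a = otype (wo_seg x).
Proof.
rewrite -(otype_repr a); move: (repr a) => V {a}; split=> [|[x ->]].
  rewrite lt_def => /andP[/eqP neq /ord_leP[f [fm fi]]].
  have [|x nx xmin] := @wo_min W (fun y => ~ exists x, f x = y).
    apply/existsNP => fsurj; apply/neq/esym/otype_eq; exact: wo_iso_surj fm fsurj.
  have fx v : ~~ wo_le x (f v) by apply/negP => /fi.
  exists x; apply: otype_eq.
  apply: (@wo_iso_surj V (wo_seg x) (fun v => exist _ (f v) (fx v))).
    by move=> u v; apply: fm.
  move=> [y yx]; have [[v fv]|nfy] := pselect (exists v, f v = y).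
    by exists v; apply: val_inj.
  by have := xmin y nfy; rewrite (negPf yx).
rewrite lt_def; apply/andP; split.
  apply/eqP => e; have /ord_leP[f [fm _]] : otype W <= otype (wo_seg x) by rewrite e.
  have /negP := valP (f x); apply; apply: (@wo_mono_ge W (val \o f)).
  by move=> y z; rewrite -(fm y z).
apply/ord_leP; exists val; split=> // y z zy.
suff zx : ~~ wo_le x z by exists (exist _ z zx).
by apply: contra (valP y) => xz; exact: wo_trans xz zy.
Qed.

Lemma Ord_min_exists (P : set Ord) : P !=set0 ->
  exists2 a, P a & forall b, P b -> a <= b.
Proof.
move=> [a Pa]; have [ex|nex] := pselect (exists2 b, P b & b < a); last first.
  exists a => // b Pb; rewrite leNgt; apply/negP => ba; apply: nex.
  by exists b.
move: ex; rewrite -(otype_repr a) => -[b Pb /lt_otypeP[x bE]].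
have [|y Py ymin] := @wo_min (repr a) (fun x => P (otype (wo_seg x))).
  by exists x; rewrite -bE.
exists (otype (wo_seg y)) => // c Pc; rewrite leNgt; apply/negP => cy.
have /lt_otypeP[z cz] : c < otype (repr a).
  by apply: (lt_trans cy); apply/lt_otypeP; exists y.
subst c; have yz := ymin z Pc; move: cy; rewrite ltNge => /negP; apply.
apply/ord_leP; exists (fun t : wo_seg y => exist _ (val t) (wo_lt_le (valP t) yz)).
split=> // t u ut.
suff uy : ~~ wo_le y (val u) by exists (exist _ (val u) uy); apply: val_inj.
by apply: contra (valP t) => yu; exact: wo_trans yu ut.
Qed.

(** An ordinal as the set of the smaller ones. *)
Definition below (a : Ord) : set Ord := [set b | b < a].

Lemma void_well_order : well_order (fun _ _ : void => true).
Proof. by move=> A [[]]. Qed.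

Definition Ord0 : Ord := otype (Wo void_well_order).

HB.instance Definition _ := isPointed.Build Ord Ord0.

(** The least element of [P] (see [Ord_min_exists]), and [Ord0] if [P] is empty. *)
Definition Ord_min (P : set Ord) : Ord :=
  xget Ord0 [set a | P a /\ forall b, P b -> a <= b].

(** The order type of a set of ordinals; [Ord0] if [A] is a proper class, which
    does not happen when [A] is included in some [below a]. *)
Definition otp (A : set Ord) : Ord :=
  xget Ord0 [set a | exists2 f : Ord -> Ord,
    set_bij (below a) A f & {in below a &, {mono f : x y / x <= y}}].

(** The initial ordinal equinumerous to [A]; [Ord0] if [A] is a proper class. *)
Definition cardinality T (A : set T) : Ord := Ord_min [set a | below a #= A].

Definition is_cardinal (a : Ord) := cardinality (below a) = a.

Definition is_infinite_cardinal (a : Ord) :=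
  is_cardinal a /\ infinite_set (below a).

Definition card_succ (a : Ord) : Ord := Ord_min [set b | is_cardinal b /\ a < b].

Definition card_pow2 (a : Ord) : Ord :=
  cardinality [set X : set Ord | X `<=` below a].

(** For a limit [a], unbounded; for a successor [a], the sets [A] that contain
    the largest element of [a], as needed for [cf]. *)
Definition unbounded_in (a : Ord) (A : set Ord) :=
  A `<=` below a /\ forall x, x < a -> exists2 y, A y & x <= y.

Definition cf (a : Ord) : Ord :=
  Ord_min [set b | exists2 A, unbounded_in a A & otp A = b].

Definition is_regular_cardinal (a : Ord) := is_infinite_cardinal a /\ cf a = a.

(** A colouring of [[kappa]^2] is a function of two ordinals, of which only the
    values at pairs [alpha < beta < kappa] matter. *)
Definition is_colouring (kappa theta : Ord) (c : Ord -> Ord -> Ord) :=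
  forall alpha beta, alpha < beta -> beta < kappa -> c alpha beta < theta.

Definition upper_regressive (kappa : Ord) (c : Ord -> Ord -> Ord) :=
  forall alpha beta, alpha < beta -> beta < kappa -> c alpha beta < beta.

(** unbounded({nu}, J^bd[kappa], theta); as [nu <= kappa], [eta < nu] is an
    ordinal below [kappa], so that [c eta beta] makes sense. *)
Definition unbounded_Jbd (nu kappa theta : Ord) :=
  exists c, [/\ is_colouring kappa theta c, upper_regressive kappa c &
    forall B, unbounded_in kappa B ->
      exists2 eta, eta < nu &
        otp [set c eta beta | beta in [set beta | B beta /\ eta < beta]] = theta].

(* Main.v *)
Require Import Defs.
From mathcomp Require Import all_boot all_order.
From mathcomp Require Import boolp wochoice classical_sets functions cardinality.

Set Implicit Arguments.
Unset Strict Implicit.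
Unset Printing Implicit Defensive.

Import Order.TTheory.
Local Open Scope classical_set_scope.
Local Open Scope card_scope.
Local Open Scope order_scope.

(** If each [beta < kappa] is assigned one of fewer than [kappa] codes, then an
    unbounded set of [beta] shares the same code; the result follows by choosing
    codes that control all the sets of colours [c eta beta], [eta < nu].
    - If [nu < cf theta] and [theta < kappa], the code is a bound below
      [theta] of the colours of [beta].
    - If [card_succ nu < cf theta], then [theta = kappa] by the previous point, and
      upper-regressivity at an ordinal [beta] of cofinality [card_succ nu] bounds
      its colours below [beta]; a closing-off argument then yields the same bound
      for an unbounded set of [beta].
    - If [cf theta <= nu] and [card_pow2 nu < kappa], the code is the comparison of
      the colours of [beta] with the elements of a cofinal subset of [theta] of
      size at most [nu] (all of [theta], if it is finite). The remaining case
      [theta = kappa] of the last inequality follows from the second one. *)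

(** * Least ordinals and comparison of cardinalities *)

Lemma Ord_minP (P : set Ord) : P !=set0 ->
  P (Ord_min P) /\ forall b, P b -> Ord_min P <= b.
Proof.
move=> /Ord_min_exists[a Pa amin].
by apply: (@xgetI _ Ord0 [set a | P a /\ forall b, P b -> a <= b] a).
Qed.

Lemma Ord_wf : well_founded (fun a b : Ord => a < b).
Proof.
move=> a; apply: contrapT => na.
have [|b nb bmin] := @Ord_min_exists [set a | ~ Acc (fun a b : Ord => a < b) a].
  by exists a.
apply: nb; constructor => c cb; apply: contrapT => /bmin.
by rewrite leNgt cb.
Qed.

(** Any choice of [y] for each [x] is injective. The relational form suits injections given by cases
    or through a parametrization. *)
Lemma card_le_rel T U (A : set T) (B : set U) (R : T -> U -> Prop) :
  (forall x, A x -> exists2 y, B y & R x y) ->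
  (forall x x' y, A x -> A x' -> R x y -> R x' y -> x = x') -> A #<= B.
Proof.
move=> Rtot Rinj; have [->|/set0P[x0 Ax0]] := eqVneq A set0; first exact: card_ge0.
have [y0 _ _] := Rtot _ Ax0.
have /choice[f fP] : forall x, exists y, A x -> B y /\ R x y.
  move=> x; have [/Rtot[y]|nAx] := pselect (A x); first by exists y.
  by exists y0.
have fi : {in A &, injective f}.
  move=> x y; rewrite !inE => Ax Ay e; apply: (Rinj x y (f x)) => //.
    exact: (fP _ Ax).2.
  by rewrite e; exact: (fP _ Ay).2.
rewrite -(card_le_eql (inj_card_eq fi)); apply: subset_card_le => _ [x Ax <-].
exact: (fP _ Ax).1.
Qed.

Lemma card_le_fun T U (A : set T) (B : set U) (f : T -> U) :
  (forall x, A x -> B (f x)) ->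
  (forall x y, A x -> A y -> f x = f y -> x = y) -> A #<= B.
Proof.
move=> fAB fi; apply: (@card_le_rel _ _ A B (fun x y => y = f x)).
  by move=> x Ax; exists (f x); [exact: fAB|].
by move=> x x' y Ax Ax' -> /fi; exact.
Qed.

Lemma card_le_ex T (U : pointedType) (A : set T) (B : set U) : A #<= B ->
  exists2 f : T -> U, (forall x, A x -> B (f x)) &
    (forall x y, A x -> A y -> f x = f y -> x = y).
Proof.
move=> /pcard_leP/injfunPex[f fAB fi]; exists f => // x y Ax Ay.
by apply: fi; rewrite inE.
Qed.

(** A relation, since a function defined on all of [T] need not exist when [U] is empty. *)
Lemma card_le_relP T U (A : set T) (B : set U) : A #<= B ->
  exists2 R : T -> U -> Prop, forall x, A x -> exists2 y, B y & R x y &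
    forall x x' y, A x -> A x' -> R x y -> R x' y -> x = x'.
Proof.
move=> /card_leP/injfunPex[f _ fi].
exists (fun x y => exists2 a : A, set_val a = x & set_val (f a) = y).
  move=> x Ax; exists (set_val (f (SigSub (mem_set Ax)))).
    exact: set_valP.
  by exists (SigSub (mem_set Ax)).
move=> x x' y _ _ [a <- <-] [a' <-] /val_inj/fi -> //; exact: in_setT.
Qed.

Lemma card_le_setX T T' U U' (A : set T) (B : set U) (A' : set T') (B' : set U') :
  A #<= B -> A' #<= B' -> A `*` A' #<= B `*` B'.
Proof.
move=> /card_le_relP[r rt ri] /card_le_relP[r' rt' ri'].
apply: (@card_le_rel _ _ _ _ (fun p q => r p.1 q.1 /\ r' p.2 q.2)).
  move=> [x x'] [/= /rt[y By xy] /rt'[y' By' xy']].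
  by exists (y, y').
move=> [x x'] [z z'] [y y'] [/= Ax Ax'] [/= Az Az'] [xy xy'] [zy zy'].
by rewrite (ri _ _ _ Ax Az xy zy) (ri' _ _ _ Ax' Az' xy' zy').
Qed.

(** * Elements of a well-order as ordinals; order types of sets of ordinals *)

Definition typ (W : wo) (x : W) : Ord := otype (wo_seg x).

Lemma typ_lt (W : wo) (x : W) : typ x < otype W.
Proof. by apply/lt_otypeP; exists x. Qed.

Lemma typ_le (W : wo) (x y : W) : (typ x <= typ y) = wo_le x y.
Proof.
apply/idP/idP => [xy|xy].
  apply: contrapT => /negP yx.
  move: xy; rewrite /typ => /ord_leP[f [fm _]].
  pose h (t : wo_seg x) : wo_seg x :=
    exist _ (val (f t)) (wo_lt_le (valP (f t)) (wo_ltW yx)).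
  have /negP := valP (f (exist _ y yx)); apply.
  exact: (@wo_mono_ge (wo_seg x) h (exist _ y yx) (fun _ _ => fm _ _)).
apply/ord_leP; exists (fun t : wo_seg x => exist _ (val t) (wo_lt_le (valP t) xy)).
split=> // t u ut.
suff ux : ~~ wo_le x (val u) by exists (exist _ (val u) ux); apply: val_inj.
by apply: contra (valP t) => xu; exact: wo_trans xu ut.
Qed.

Lemma typ_inj (W : wo) : injective (@typ W).
Proof. by move=> x y e; apply: wo_anti; rewrite -typ_le e. Qed.

Lemma typ_surj (W : wo) b : b < otype W -> exists x : W, typ x = b.
Proof. by move=> /lt_otypeP[x ->]; exists x. Qed.

Lemma card_otype (W : wo) : below (otype W) #= [set: W].
Proof.
rewrite card_eq_le; apply/andP; split.
  apply: (@card_le_rel _ _ _ _ (fun a x => typ x = a)).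
    by move=> a /typ_surj[x <-]; exists x.
  by move=> a a' x _ _ <-.
apply: (@card_le_fun _ _ _ _ (@typ W)) => x; first by move=> _; exact: typ_lt.
by move=> y _ _ /typ_inj.
Qed.

Lemma well_order_preim T (W : wo) (k : T -> W) : injective k ->
  well_order (fun x y => wo_le (k x) (k y)).
Proof.
move=> ki A [a Aa].
have [|_ [y Ay ->] zmin] := @wo_min W (fun y => exists2 z, z \in A & y = k z).
  by exists (k a); exists a.
exists y; split=> [|y' [Ay' y'min]]; first by split=> // z' Az'; apply: zmin; exists z'.
by apply/ki/wo_anti; [apply: zmin; exists y' | exact: y'min].
Qed.

Definition lex_le (V W : wo) (p q : V * W) :=
  wo_le p.1 q.1 && (wo_le q.1 p.1 ==> wo_le p.2 q.2).

Lemma lex_well_order (V W : wo) : well_order (@lex_le V W).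
Proof.
apply: antisymmetric_well_order.
  move=> [x y] [x' y'] /andP[/andP[/= xx' yy'] /andP[/= x'x y'y]].
  move: yy' y'y; rewrite (wo_anti xx' x'x) wo_refl /= => yy' y'y.
  by rewrite (wo_anti yy' y'y).
move=> A [[x0 y0] Axy].
have [|x [y Axy'] xmin] := @wo_min V (fun x => exists y, (x, y) \in A).
  by exists x0, y0.
have [|z Az zmin] := @wo_min W (fun y => (x, y) \in A); first by exists y.
exists (x, z); split=> // -[u v] Auv; rewrite /lex_le /=.
have xu : wo_le x u by apply: xmin; exists v.
rewrite xu /=; apply/implyP => ux; apply: zmin.
by rewrite (wo_anti xu ux).
Qed.

(** By induction [x <= f x] for [x < a], so that [b < a] would give [b <= f b < b]. *)
Lemma strict_mono_le (a b : Ord) (f : Ord -> Ord) :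
  (forall x, x < a -> f x < b) ->
  (forall x y, x < y -> y < a -> f x < f y) -> a <= b.
Proof.
move=> fab fm; have fge x : x < a -> x <= f x.
  elim/(well_founded_ind Ord_wf): x => x IH xa; rewrite leNgt; apply/negP => fx.
  have fxa := lt_trans fx xa.
  by have := IH _ fx fxa; rewrite leNgt fm.
rewrite leNgt; apply/negP => ba.
by have := fge _ ba; rewrite leNgt fab.
Qed.

(** The elements of [W] whose type is in [A], with the induced order, provide the order type, so
    that [otp A] is not a default value. *)
Lemma otp_bij (a : Ord) (A : set Ord) : A `<=` below a -> exists2 f : Ord -> Ord,
  set_bij (below (otp A)) A f & {in below (otp A) &, {mono f : x y / x <= y}}.
Proof.
rewrite -(otype_repr a); move: (repr a) => W {a} AW.
pose V := Wo (@well_order_preim {x : W | `[< A (typ x) >]} W val val_inj).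
pose P : set Ord := [set b | exists2 f : Ord -> Ord,
  set_bij (below b) A f & {in below b &, {mono f : x y / x <= y}}].
suff : P (otype V) by apply: (@xgetI _ Ord0 P).
pose f b := xget Ord0 [set y | exists2 v : V, b = typ v & y = typ (val v)].
have fE (v : V) : f (typ v) = typ (val v).
  have [|w /typ_inj <- //] := @xgetPex _ Ord0
    [set y | exists2 w : V, typ v = typ w & y = typ (val w)].
  by exists (typ (val v)), v.
have fm : {in below (otype V) &, {mono f : x y / x <= y}}.
  move=> x y; rewrite !inE => /typ_surj[v <-] /typ_surj[w <-].
  by rewrite !fE !typ_le.
exists f => //; split.
- by move=> _ /typ_surj[v <-]; rewrite fE; exact/asboolP/(valP v).
- move=> x y xV yV e; apply/eqP; rewrite eq_le -(fm x y) // -(fm y x) //.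
  by rewrite e lexx.
- move=> y Ay; have [x xy] := typ_surj (AW _ Ay).
  have Ax : `[< A (typ x) >] by apply/asboolP; rewrite xy.
  exists (typ (exist _ x Ax : V)); first exact: typ_lt.
  by rewrite fE.
Qed.

Lemma below_subset (a b : Ord) : a <= b -> below a `<=` below b.
Proof. by move=> ab x /= xa; exact: lt_le_trans xa ab. Qed.

Lemma otp_card (a : Ord) (A : set Ord) : A `<=` below a -> below (otp A) #= A.
Proof. by move=> /otp_bij[f fb _]; apply/card_set_bijP; exists f. Qed.

Lemma Ord0_le (b : Ord) : Ord0 <= b.
Proof.
rewrite -(otype_repr b); apply/ord_leP.
by exists (fun v : Wo void_well_order => match v with end); split=> [[]|[]].
Qed.

Lemma otp_le (b : Ord) (A : set Ord) (g : Ord -> Ord) :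
  (forall x, A x -> g x < b) ->
  (forall x y, A x -> A y -> x < y -> g x < g y) -> otp A <= b.
Proof.
move=> gb gm; rewrite /otp; case: xgetP; last by move=> _; exact: Ord0_le.
move=> a _ [f [fA _ _] fm]; apply: (@strict_mono_le _ _ (g \o f)).
  by move=> x xa; apply/gb/fA.
move=> x y xy ya; apply: gm; rewrite ?ltNge ?fm ?inE //= -?ltNge //.
- by apply: fA; exact: lt_trans xy ya.
- exact: fA.
- exact: lt_trans xy ya.
Qed.

Lemma otp_le_below (b : Ord) (A : set Ord) : A `<=` below b -> otp A <= b.
Proof. by move=> Ab; apply: (@otp_le b A id). Qed.

(** * Cardinals: squares, power sets and successors *)

Lemma cardinalityP T (A : set T) : (exists a, below a #= A) ->
  [/\ below (cardinality A) #= A, is_cardinal (cardinality A) &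
      forall a, below a #= A -> cardinality A <= a].
Proof.
move=> ex; have [cA cmin] := @Ord_minP [set a | below a #= A] ex.
split=> //; apply/eqP; rewrite eq_le; apply/andP.
have [|cc ccmin] := @Ord_minP [set a | below a #= below (cardinality A)].
  by exists (cardinality A); exact: card_eqxx.
split; first exact/ccmin/card_eqxx.
exact/cmin/(card_eq_trans cc).
Qed.

(** The image of an injection has an order type that is at most [b] and equinumerous to [a], hence
    at least [a]. *)
Lemma cardinal_le (a b : Ord) : is_cardinal a -> below a #<= below b -> a <= b.
Proof.
move=> ca /card_le_ex[f fb fi].
have fA : f @` below a #= below a.
  by apply: inj_card_eq => x y; rewrite !inE; exact: fi.
have fsub : f @` below a `<=` below b by move=> _ [x xa <-]; exact: fb.
rewrite -ca; apply: le_trans (otp_le_below fsub).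
have [] := @cardinalityP _ (below a); first by exists a; exact: card_eqxx.
by move=> _ _; apply; apply: card_eq_trans (otp_card fsub) fA.
Qed.

(** Otherwise [below a] is [below x] with [x] added, which is finite or no larger than [below x]. *)
Lemma infinite_cardinal_limit (a x : Ord) : is_infinite_cardinal a -> x < a ->
  exists2 y, x < y & y < a.
Proof.
move=> [ca ainf] xa; apply: contrapT => nex.
have aE : below a `<=` below x `|` [set x].
  move=> y ya; have [yx|xy|->] := ltgtP y x; [by left| |by right].
  by exfalso; apply: nex; exists y.
have [xfin|xinf] := pselect (finite_set (below x)).
  by apply/ainf/(sub_finite_set aE); rewrite finite_setU; split.
suff : below a #<= below x by move=> /(cardinal_le ca); rewrite leNgt xa.
have /infiniteP/card_le_ex[g gx gi] := xinf.
have gi' m n : g m = g n -> m = n by exact: gi.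
have gnx n : g n <> x by move=> e; have := gx n I; rewrite /below /= e ltxx.
(* Hilbert's hotel: [x] goes to [g 0], each [g n] to [g n.+1], and the other elements stay. *)
apply: (@card_le_rel _ _ _ _ (fun y z => [\/ y = x /\ z = g 0,
  exists2 n, y = g n & z = g n.+1 | [/\ y <> x, ~ range g y & z = y]])).
  move=> y ya; have [->|/eqP yx] := eqVneq y x.
    by exists (g 0); [exact: gx|constructor 1].
  have [[n _ <-]|ny] := pselect (range g y).
    by exists (g n.+1); [exact: gx|constructor 2; exists n].
  by exists y; [case: (aE _ ya)|constructor 3].
move=> y y' z _ _ [[-> ->]|[n -> ->]|[yx ny ->]] [[-> e]|[n' -> e]|[yx' ny' e]] //.
- by have := gi' _ _ e.
- by case: ny'; rewrite -e; exists 0.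
- by have := gi' _ _ e.
- by have [->] := gi' _ _ e.
- by case: ny'; rewrite -e; exists n.+1.
- by case: ny; rewrite e; exists 0.
- by case: ny; rewrite e; exists n'.+1.
Qed.

Definition wo_max (W : wo) (x y : W) := if wo_le x y then y else x.

Lemma wo_le_maxl (W : wo) (x y : W) : wo_le x (wo_max x y).
Proof. by rewrite /wo_max; case: ifP => // _; exact: wo_refl. Qed.

Lemma wo_le_maxr (W : wo) (x y : W) : wo_le y (wo_max x y).
Proof.
rewrite /wo_max; case: ifP => [_|/negbT/wo_ltW //]; exact: wo_refl.
Qed.

(* Goedel's order: pairs sorted by their maximum first, so that each proper
   initial segment lies in a square [below b `*` below b] with [b < a]. *)
Lemma infinite_cardinal_setX (a : Ord) : is_infinite_cardinal a ->
  below a `*` below a #<= below a.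
Proof.
elim/(well_founded_ind Ord_wf): a => a IH /[dup] aC [ca ainf].
pose W := repr a; have WE : otype W = a by exact: otype_repr.
pose k (p : W * W) : Wo (@lex_well_order W (Wo (@lex_well_order W W))) :=
  (wo_max p.1 p.2, p).
have ki : injective k by move=> p q [].
pose G := Wo (well_order_preim ki).
have GE : otype G <= a.
  rewrite leNgt; apply/negP => /typ_surj[p pE].
  have ma : typ (wo_max p.1 p.2) < a by rewrite -WE; exact: typ_lt.
  have [b mb ba] := infinite_cardinal_limit aC ma.
  have le_b (q : wo_seg p) : typ (val q).1 < b /\ typ (val q).2 < b.
    have qm : wo_le (wo_max (val q).1 (val q).2) (wo_max p.1 p.2).
      by have /wo_ltW/andP[] := valP q.
    by split; apply: le_lt_trans mb; rewrite typ_le; apply: wo_trans qm;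
      [exact: wo_le_maxl|exact: wo_le_maxr].
  have ab2 : below a #<= below b `*` below b.
    rewrite -pE (card_le_eql (card_otype (wo_seg p))).
    apply: (@card_le_fun _ _ _ _ (fun q : wo_seg p => (typ (val q).1, typ (val q).2))).
      by move=> q _; exact: le_b.
    move=> q q' _ _ [e e']; apply/val_inj.
    move: e e'; case: q q' => [[x y] ?] [[x' y'] ?] /=.
    by move=> /typ_inj e /typ_inj e'; rewrite e e'.
  (* The square of a finite [b] is finite; for an infinite [b] the induction hypothesis applies to
     its cardinality. *)
  have [bfin|binf] := pselect (finite_set (below b)).
    apply: ainf; apply: card_le_finite ab2 _; exact: finite_setX.
  have [|bE cb cmin] := @cardinalityP _ (below b).
    by exists b; exact: card_eqxx.
  have cba : cardinality (below b) < a.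
    by apply: le_lt_trans ba; exact/cmin/card_eqxx.
  have cC : is_infinite_cardinal (cardinality (below b)).
    by split=> //; rewrite (eq_finite_set bE).
  have : below a #<= below (cardinality (below b)).
    apply: (card_le_trans ab2); apply: card_le_trans (IH _ cba cC).
    by move: bE; rewrite card_eq_le => /andP[_ ?]; exact: card_le_setX.
  by move=> /(cardinal_le ca); rewrite leNgt cba.
apply: (@card_le_rel _ _ _ _ (fun p z => exists2 q : G,
  p = (typ q.1, typ q.2) & z = typ q)).
  rewrite -{1 2}WE => -[x y] [/= /typ_surj[u <-] /typ_surj[v <-]].
  exists (@typ G (u, v)); last by exists (u, v).
  exact: lt_le_trans (typ_lt _) GE.
by move=> p p' z _ _ [q -> ->] [q' -> /typ_inj ->].
Qed.

Lemma card_le_powerset T U (A : set T) (B : set U) : A #<= B ->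
  [set X | X `<=` A] #<= [set Y | Y `<=` B].
Proof.
move=> /card_le_relP[R Rt Ri].
apply: (@card_le_fun _ _ _ _
  (fun X => [set y | B y /\ exists2 x, X x & R x y])) => [X XA y []//|X X' XA XA' e].
suff H (Y Y' : set T) : Y `<=` A -> Y' `<=` A ->
    [set y | B y /\ exists2 x, Y x & R x y] `<=`
    [set y | B y /\ exists2 x, Y' x & R x y] -> Y `<=` Y'.
  by apply/seteqP; split; apply: H => //; rewrite e.
move=> YA YA' YY' x Yx; have [y By Rxy] := Rt _ (YA _ Yx).
have [|_ [x' Yx' Rx'y]] := YY' y; first by split=> //; exists x.
by rewrite (Ri _ _ _ (YA _ Yx) (YA' _ Yx') Rxy Rx'y).
Qed.

Lemma card_pow2P (a : Ord) :
  below (card_pow2 a) #= [set X | X `<=` below a] /\ is_cardinal (card_pow2 a).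
Proof.
suff ex : exists b, below b #= [set X | X `<=` below a].
  by have [] := cardinalityP ex.
(* Subsets of the carrier [repr a], because sets of ordinals live in too large a universe for
   [wo_sort]. *)
have [r rwo] := well_ordering_principle (set (repr a)).
exists (otype (@Wo (repr a -> Prop) r rwo)).
rewrite (card_eql (card_otype _)).
have h : [set: set (repr a)] #= [set X | X `<=` [set: repr a]].
  have -> : [set X | X `<=` [set: repr a]] = [set: set (repr a)].
    by apply/seteqP; split=> X _ //.
  exact: card_eqxx.
rewrite (card_eql h) card_eq_le.
have := card_otype (repr a); rewrite otype_repr card_eq_le => /andP[l1 l2].
by rewrite !card_le_powerset.
Qed.

(** Cantor's diagonal argument, against an injection of the subsets of [below a] into [below a]. *)
Lemma lt_card_pow2 (a : Ord) : a < card_pow2 a.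
Proof.
have [pE _] := card_pow2P a.
rewrite ltNge; apply/negP => /below_subset/subset_card_le.
rewrite (card_le_eql pE) => /card_le_ex[f fa fi].
pose D := [set y | y < a /\ exists2 X, X `<=` below a & f X = y /\ ~ X y].
have Da : D `<=` below a by move=> y [].
have nD : ~ D (f D).
  move=> /[dup] Df [_ [X Xa [e]]]; rewrite (fi _ _ Xa Da e); exact.
by apply: (nD); split; [exact: fa|exists D].
Qed.

Lemma card_succP (a : Ord) : [/\ is_cardinal (card_succ a), a < card_succ a &
  forall b, is_cardinal b -> a < b -> card_succ a <= b].
Proof.
have [|[sc sa] smin] := @Ord_minP [set b | is_cardinal b /\ a < b].
  by exists (card_pow2 a); split; [exact: (card_pow2P a).2|exact: lt_card_pow2].
by split=> // b cb ab; apply: smin.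
Qed.

Lemma lt_card_succ (a b : Ord) : b < card_succ a -> below b #<= below a.
Proof.
move=> bs; have [|bE cb cmin] := @cardinalityP _ (below b).
  by exists b; exact: card_eqxx.
rewrite -(card_le_eql bE); apply/subset_card_le/below_subset.
rewrite leNgt; apply/negP => /(let: And3 _ _ h := card_succP a in h _ cb).
apply/negP; rewrite -ltNge; apply: le_lt_trans bs; exact/cmin/card_eqxx.
Qed.

Lemma card_succ_infinite (a : Ord) :
  is_infinite_cardinal a -> is_infinite_cardinal (card_succ a).
Proof.
move=> [ca ainf]; have [sc sa _] := card_succP a; split=> //.
by apply: sub_infinite_set ainf; exact/below_subset/ltW.
Qed.

(** Regularity of the successor: otherwise [card_succ a] is covered by [a] initial segments of size
    at most [a], and so embeds in the square of [a]. *)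
Lemma card_succ_bounded (a : Ord) (F : Ord -> Ord) : is_infinite_cardinal a ->
  (forall i, i < a -> F i < card_succ a) ->
  exists2 b, b < card_succ a & forall i, i < a -> F i < b.
Proof.
move=> aC Fs; apply: contrapT => nex.
have [sc sa _] := card_succP a.
have sC := card_succ_infinite aC.
suff : below (card_succ a) #<= below a.
  by move=> /(cardinal_le sc); rewrite leNgt sa.
apply: card_le_trans (infinite_cardinal_setX aC).
have /choice[e eP] : forall i, exists e : Ord -> Ord, i < a ->
    (forall x, x <= F i -> e x < a) /\
    (forall x y, x <= F i -> y <= F i -> e x = e y -> x = y).
  move=> i; have [ia|] := boolP (i < a); last by exists id.
  have [b Fb bs] := infinite_cardinal_limit sC (Fs _ ia).
  have /card_le_ex[e ea ei] := lt_card_succ bs.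
  exists e => _; split=> [x xF|x y xF yF]; first exact/ea/(le_lt_trans xF).
  by apply: ei; [exact: le_lt_trans xF Fb|exact: le_lt_trans yF Fb].
apply: (@card_le_rel _ _ _ _ (fun x p => [/\ p.1 < a, x <= F p.1 & p.2 = e p.1 x])).
  move=> x xs; apply: contrapT => nx; apply: nex; exists x => // i ia.
  rewrite ltNge; apply/negP => xF; apply: nx; exists (i, e i x) => //.
  by split=> //=; have [+ _] := eP _ ia; exact.
move=> x x' [i z] _ _ [/= ia xF ->] [_ xF' /=].
by have [_ +] := eP _ ia; exact.
Qed.

(** * Cofinality and regular cardinals *)

Lemma cfP (a : Ord) : (exists2 A, unbounded_in a A & below (cf a) #= A) /\
  forall A, unbounded_in a A -> cf a <= otp A.
Proof.
have [|[A Au AE] cmin] := @Ord_minP [set b | exists2 A, unbounded_in a A & otp A = b].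
  by exists (otp (below a)), (below a) => //; split=> // x xa; exists x.
split=> [|B Bu]; last by apply: cmin; exists B.
by exists A => //; rewrite /cf -AE; apply: otp_card; exact: Au.1.
Qed.

Lemma cf_le (a : Ord) : cf a <= a.
Proof.
apply: (@le_trans _ _ (otp (below a))); last exact: otp_le_below.
by apply: (cfP a).2; split=> // x xa; exists x.
Qed.

(* The records of [F] (values larger than all the previous ones) have order type
   at most [b] and are cofinal with its range. *)
Lemma cf_bounded (a b : Ord) (F : Ord -> Ord) : b < cf a ->
  (forall i, i < b -> F i < a) -> exists2 x, x < a & forall i, i < b -> F i < x.
Proof.
move=> bcf Fa; apply: contrapT => nex.
pose rec i := i < b /\ forall j, j < i -> F j < F i.
pose A := F @` rec.
have Au : unbounded_in a A.
  split=> [_ [i [ib _] <-]|x xa]; first exact: Fa.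
  (* The first index at which [F] reaches [x] is a record. *)
  have [|i [ib xF] imin] := @Ord_min_exists [set i | i < b /\ x <= F i].
    apply: contrapT => ni; apply: nex; exists x => // i ib.
    by rewrite ltNge; apply/negP => xF; apply: ni; exists i.
  exists (F i) => //; exists i => //; split=> // j ji.
  apply: lt_le_trans xF; rewrite ltNge; apply/negP => xj.
  by have := imin j (conj (lt_trans ji ib) xj); rewrite leNgt ji.
have rm i j : rec i -> rec j -> F i < F j -> i < j.
  move=> [_ ri] _ Fij; rewrite ltNge; apply/negP; rewrite le_eqVlt.
  by move=> /orP[/eqP ji|/ri /(lt_trans Fij)]; [move: Fij; rewrite ji|]; rewrite ltxx.
pose g y := xget Ord0 [set i | rec i /\ F i = y].
have gP i : rec i -> rec (g (F i)) /\ F (g (F i)) = F i.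
  by move=> ri; apply: (@xgetI _ Ord0 [set j | rec j /\ F j = F i] i).
have : otp A <= b.
  apply: (@otp_le b A g) => [_ [i ri <-]|_ _ [i ri <-] [j rj <-] Fij].
    by have [[]] := gP _ ri.
  have [ri' ei] := gP _ ri; have [rj' ej] := gP _ rj.
  by apply: rm => //; rewrite ei ej.
by move=> /(le_trans ((cfP a).2 _ Au)); rewrite leNgt bcf.
Qed.

Lemma not_unbounded_in (a : Ord) (P : set Ord) : P `<=` below a ->
  ~ unbounded_in a P -> exists2 x, x < a & forall y, P y -> y < x.
Proof.
move=> Pa nu; apply: contrapT => nex; apply: nu; split=> // x xa.
apply: contrapT => nx; apply: nex; exists x => // y Py.
by rewrite ltNge; apply/negP => xy; apply: nx; exists y.
Qed.

(** Otherwise every class of the code is bounded, and by regularity one [x < kappa] exceeds all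
    these bounds; but [x] lies in a class itself. *)
Lemma regular_pigeonhole (kappa s : Ord) T (C : set T) (code : Ord -> T) :
  is_regular_cardinal kappa -> s < kappa -> C #<= below s ->
  (forall beta, beta < kappa -> C (code beta)) ->
  exists t, unbounded_in kappa [set beta | beta < kappa /\ code beta = t].
Proof.
move=> [_ kcf] sk /card_le_ex[e es ei] codeC; apply: contrapT => nex.
have /choice[F FP] : forall i, exists x, x < kappa /\
    forall beta, beta < kappa -> e (code beta) = i -> beta < x.
  move=> i.
  have [[b [bk bi]]|nb] := pselect (exists b, b < kappa /\ e (code b) = i); last first.
    exists s; split=> // beta betak betai.
    by exfalso; apply: nb; exists beta.
  have [||x xk xP] := @not_unbounded_in kappa [set beta | beta < kappa /\ code beta = code b].
  - by move=> y [].
  - by move=> u; apply: nex; exists (code b).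
  exists x; split=> // beta betak betai; apply: xP; split=> //.
  by apply: ei; [exact: codeC..|rewrite betai].
have [||x xk xP] := @cf_bounded kappa s F; first by rewrite kcf.
  by move=> i _; exact: (FP i).1.
have h := (FP (e (code x))).2 x xk erefl.
by have := lt_trans h (xP _ (es _ (codeC _ xk))); rewrite ltxx.
Qed.

Lemma cardinality_II n : below (cardinality `I_n) #= `I_n.
Proof.
(* Not on ['I_n], whose universe is too large for [wo_sort]. *)
have [r rwo] := well_ordering_principle {k : nat | (k < n)%N}.
have [|//] := @cardinalityP _ `I_n.
exists (otype (@Wo {k : nat | (k < n)%N} r rwo)).
rewrite (card_eql (card_otype _)) card_eq_le; apply/andP; split.
  apply: (@card_le_fun _ _ _ _ (fun k : {k : nat | (k < n)%N} => val k)).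
    by move=> k _; exact: (valP k).
  by move=> k k' _ _ /val_inj.
apply: (@card_le_rel _ _ _ _ (fun k (k' : {k : nat | (k < n)%N}) => k = val k')).
  by move=> k kn; exists (exist _ k kn).
by move=> k l k' _ _ -> ->.
Qed.

(** Transfinite recursion: [h i] is the least ordinal above all the earlier [h j] and [g (h j)], and
    regularity keeps it below [kappa]. *)
Lemma regular_closure_seq (kappa s : Ord) (g : Ord -> Ord) :
  is_regular_cardinal kappa -> s < kappa ->
  (forall x, x < kappa -> g x < kappa) ->
  exists2 h : Ord -> Ord, (forall i, i < s -> h i < kappa) &
    (forall i j, i < j -> j < s -> h i < h j /\ g (h i) < h j).
Proof.
move=> [_ kcf] sk gk.
pose F i (rec : forall j : Ord, j < i -> Ord) : Ord :=
  Ord_min [set x | forall j (ji : j < i), rec j ji < x /\ g (rec j ji) < x].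
pose h : Ord -> Ord := Fix Ord_wf _ F.
have hE i : h i = Ord_min [set x | forall j, j < i -> h j < x /\ g (h j) < x].
  rewrite /h Fix_eq // => {}i f f' ff'; suff -> : f = f' by [].
  by apply: functional_extensionality_dep => j; exact: functional_extensionality_dep.
have hP i : (forall j, j < i -> h j < kappa) -> i < kappa ->
    h i < kappa /\ forall j, j < i -> h j < h i /\ g (h j) < h i.
  move=> hk ik.
  have [||x xk xP] := @cf_bounded kappa i (fun j => Order.max (h j) (g (h j))).
  - by rewrite kcf.
  - by move=> j ji; rewrite gt_max hk // gk // hk.
  have xs : [set x | forall j, j < i -> h j < x /\ g (h j) < x] x.
    by move=> j /xP; rewrite gt_max => /andP.
  have [|hi hmin] := @Ord_minP [set x | forall j, j < i -> h j < x /\ g (h j) < x].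
    by exists x.
  rewrite hE; split=> //; exact: le_lt_trans (hmin _ xs) xk.
have hk i : i < kappa -> h i < kappa.
  elim/(well_founded_ind Ord_wf): i => i IH ik.
  by apply: (hP i _ ik).1 => j ji; apply: IH => //; exact: lt_trans ji ik.
exists h => [i /lt_trans/(_ sk)/hk //|i j ij js].
have jk := lt_trans js sk.
by apply: (hP j _ jk).2 => // l /lt_trans/(_ jk); exact: hk.
Qed.

(** * Unbounded sets on which the colours are controlled *)

(* If there were no such [tau], there would be [g] such that a [beta] whose
   colours [c eta beta] are bounded by [tau] is less than [g tau]. Let [beta] be
   the supremum of a sequence of length [card_succ nu] closed under [g]. Its [nu]
   colours are less than [beta], so that some term of the sequence bounds them
   and [beta] is less than a later term. *)
Lemma regular_reflection (kappa nu : Ord) (c : Ord -> Ord -> Ord) :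
  is_regular_cardinal kappa -> is_infinite_cardinal nu ->
  card_succ nu < kappa -> upper_regressive kappa c ->
  exists2 tau, tau < kappa & unbounded_in kappa
    [set beta | beta < kappa /\ forall eta, eta < nu -> eta < beta -> c eta beta < tau].
Proof.
move=> kR nuC sk creg; apply: contrapT => nex.
have [_ kcf] := kR; have [_ nus _] := card_succP nu.
have /choice[g gP] : forall tau, exists x, tau < kappa -> x < kappa /\
    forall beta, beta < kappa ->
      (forall eta, eta < nu -> eta < beta -> c eta beta < tau) -> beta < x.
  move=> tau; have [tk|] := boolP (tau < kappa); last by exists tau.
  have [||x xk xP] := @not_unbounded_in kappa
    [set beta | beta < kappa /\ forall eta, eta < nu -> eta < beta -> c eta beta < tau].
  - by move=> y [].
  - by move=> u; apply: nex; exists tau.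
  by exists x => _; split=> // beta betak betac; exact: xP.
have [|h hk hlt] := @regular_closure_seq kappa _ g kR sk.
  by move=> x xk; exact: (gP _ xk).1.
have [||x xk xP] := @cf_bounded kappa (card_succ nu) h; [by rewrite kcf|by []|].
have [|beta betaP betamin] := @Ord_min_exists [set b | forall i, i < card_succ nu -> h i <= b].
  by exists x => i /xP/ltW.
have betak : beta < kappa by apply: le_lt_trans xk; apply: betamin => i /xP/ltW.
(* As [c eta beta] is less than the least upper bound [beta] of the sequence, it is exceeded by some
   term, of index [I eta]. *)
have /choice[I IP] : forall eta, exists i, i < card_succ nu /\
    (eta < beta -> c eta beta < h i).
  move=> eta; have [eb|] := boolP (eta < beta); last by exists nu.
  apply: contrapT => ni.
  have : beta <= c eta beta.
    apply: betamin => i si; rewrite leNgt; apply/negP => ci; apply: ni.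
    by exists i.
  by rewrite leNgt creg.
have [|i si iP] := @card_succ_bounded nu I nuC; first by move=> i _; exact: (IP i).1.
have [j ij sj] := infinite_cardinal_limit (card_succ_infinite nuC) si.
have : beta < g (h i).
  apply: (gP _ (hk _ si)).2 => // eta etanu etab.
  apply: lt_trans ((IP eta).2 etab) _.
  exact: (hlt _ _ (iP _ etanu) si).1.
move=> /lt_trans/(_ (hlt _ _ ij sj).2).
by rewrite ltNge betaP.
Qed.

(* The code of [beta] is the set of the [(eta, a)] such that
   [c eta beta <= a]. *)
Lemma pow2_pigeonhole (kappa nu : Ord) (A : set Ord) (c : Ord -> Ord -> Ord) :
  is_regular_cardinal kappa -> is_infinite_cardinal nu ->
  card_pow2 nu < kappa -> A #<= below nu ->
  exists2 B, unbounded_in kappa B & forall eta beta beta' a, eta < nu ->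
    B beta -> B beta' -> eta < beta -> eta < beta' -> A a ->
    c eta beta <= a -> c eta beta' <= a.
Proof.
move=> kR nuC pk Anu.
pose code beta : set (Ord * Ord) :=
  [set p | [/\ p.1 < nu, A p.2, p.1 < beta & c p.1 beta <= p.2]].
have [||S Su] := @regular_pigeonhole kappa _ _ [set X | X `<=` below nu `*` A] code kR pk.
(* The codes are subsets of a set of pairs that embeds in the square of [nu], hence in [nu]. *)
- rewrite (card_le_eqr (card_pow2P nu).1); apply: card_le_powerset.
  apply: card_le_trans (infinite_cardinal_setX nuC).
  by apply: card_le_setX; first exact: card_lexx.
- by move=> beta _ p [].
exists [set beta | beta < kappa /\ code beta = S] => //.
move=> eta beta beta' a enu [_ bS] [_ b'S] eb eb' Aa cb.
have : code beta (eta, a) by [].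
by rewrite bS -b'S => -[].
Qed.

(** * The bounds on [theta], [cf theta] and [kappa] *)

Theorem proposition2p5 (kappa nu theta : Ord)
    (kappa_regular : is_regular_cardinal kappa)
    (nu_infinite : is_infinite_cardinal nu) (nu_le_kappa : nu <= kappa)
    (theta_cardinal : is_cardinal theta)
    (theta_ge2 : cardinality `I_2 <= theta) (theta_le_kappa : theta <= kappa)
    (unbounded_c : unbounded_Jbd nu kappa theta) :
  [/\ theta <= kappa /\ (nu < cf theta -> theta = kappa),
      cf theta <= card_succ nu &
      kappa <= card_pow2 nu].
Proof.
have [c [c_col c_reg c_unb]] := unbounded_c.
have [_ kcf] := kappa_regular.
have [sc _ smin] := card_succP nu.
(* A set of colours below [tau] has order type at most [tau], hence not [theta]. *)
have no_bound tau B : tau < theta -> unbounded_in kappa B ->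
    ~ forall eta, eta < nu -> forall beta, B beta -> eta < beta -> c eta beta < tau.
  move=> tau_theta /c_unb[eta eta_nu otpE] /(_ _ eta_nu) B_tau.
  move: tau_theta; rewrite -otpE ltNge => /negP; apply.
  by apply: otp_le_below => _ [beta [Bb eb] <-]; exact: B_tau.
have theta_eq : nu < cf theta -> theta = kappa.
  move=> nu_cf; apply/eqP; rewrite eq_le theta_le_kappa leNgt; apply/negP => tk.
  (* [Ord0] stands in below for the colours with [eta >= beta], so it has to be less than
     [theta]. *)
  have theta_gt0 : Ord0 < theta.
    exact: le_lt_trans (Ord0_le _) (lt_le_trans nu_cf (cf_le _)).
  have /choice[code codeP] : forall beta, exists tau, beta < kappa -> tau < theta /\
      forall eta, eta < nu -> eta < beta -> c eta beta < tau.
    move=> beta; have [bk|] := boolP (beta < kappa); last by exists Ord0.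
    have [|tau tt tP] :=
        @cf_bounded theta nu (fun eta => if eta < beta then c eta beta else Ord0) nu_cf.
      by move=> eta _; case: ifP => // eb; exact: c_col.
    by exists tau => _; split=> // eta /tP + eb; rewrite eb.
  have [||tau tauU] := @regular_pigeonhole kappa theta _ (below theta) code kappa_regular tk.
  - exact: card_lexx.
  - by move=> beta /codeP[].
  (* A member of the class shows that [tau] is an actual code, hence less than [theta]. *)
  have [beta [bk codeE] _] := tauU.2 _ (le_lt_trans (Ord0_le theta) tk).
  apply: (no_bound tau _ _ tauU); first by rewrite -codeE; exact: (codeP _ bk).1.
  by move=> eta enu b [bk' <-]; exact: (codeP _ bk').2.
have cf_le_succ : cf theta <= card_succ nu.
  rewrite leNgt; apply/negP => scf.
  have tE : theta = kappa by apply/theta_eq/(lt_trans _ scf); have [] := card_succP nu.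
  have [|tau tk tauU] :=
      @regular_reflection kappa nu c kappa_regular nu_infinite _ c_reg.
    by rewrite -kcf -tE.
  apply: (no_bound tau _ _ tauU); first by rewrite tE.
  by move=> eta enu beta [_]; exact.
split=> //; rewrite leNgt; apply/negP => pk.
have pow2_card := (card_pow2P nu).2.
(* In the first case [kappa = cf theta <= card_succ nu <= card_pow2 nu]. *)
have [/theta_eq tE|cf_nu] := ltP nu (cf theta).
  move: cf_le_succ; rewrite tE kcf => /le_trans/(_ (smin _ pow2_card (lt_card_pow2 _))).
  by rewrite leNgt pk.
(* A finite [theta] is no limit, so its colours are compared with all its elements: on [B] each
   [eta] then has at most one colour, against [theta >= 2]. *)
have [theta_fin|theta_inf] := pselect (finite_set (below theta)).
  have theta_nu : below theta #<= below nu.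
    apply/subset_card_le/below_subset; rewrite leNgt; apply/negP => nt.
    by apply: nu_infinite.2; apply: sub_finite_set theta_fin; exact/below_subset/ltW.
  have [B Bu Bconst] := pow2_pigeonhole c kappa_regular nu_infinite pk theta_nu.
  have [eta eta_nu otpE] := c_unb _ Bu; move: otpE; set X := [set _ | _ in _] => otpE.
  have Xtheta : X `<=` below theta.
    by move=> _ [beta [/Bu.1 bk eb] <-]; exact: c_col.
  have Xle x y : X x -> X y -> y <= x.
    move=> /[swap] -[b' [Bb' eb'] <-] -[b [Bb eb] <-].
    apply: (Bconst eta b b') => //; exact: c_col eb (Bu.1 _ Bb).
  have : `I_2 #<= `I_1.
    rewrite -(card_le_eql (cardinality_II 2)).
    apply: (card_le_trans (subset_card_le (below_subset theta_ge2))).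
    rewrite -{1}otpE (card_le_eql (otp_card Xtheta)).
    apply: (@card_le_fun _ _ _ _ (fun _ => 0)) => // x y Xx Xy _.
    by apply/eqP; rewrite eq_le !Xle.
  by rewrite card_le_II.
have [[A Au cfA] _] := cfP theta.
have A_nu : A #<= below nu.
  by rewrite -(card_le_eql cfA); exact/subset_card_le/below_subset.
have [B Bu Bconst] := pow2_pigeonhole c kappa_regular nu_infinite pk A_nu.
have [eta eta_nu otpE] := c_unb _ Bu.
(* An [a] in [A] above one colour of [eta] is above all of them on [B]; a strict bound [b] exists as
   [theta] is a limit. Without any colour, every [b < theta] will do. *)
have [b b_theta Xb] : exists2 b, b < theta &
    forall beta, B beta -> eta < beta -> c eta beta < b.
  have [[b0 [Bb0 eb0]]|nB] := pselect (exists b0, B b0 /\ eta < b0).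
    have [a Aa ca] := Au.2 _ (c_col _ _ eb0 (Bu.1 _ Bb0)).
    have [b ab bt] := infinite_cardinal_limit (conj theta_cardinal theta_inf) (Au.1 _ Aa).
    exists b => // beta Bb eb; apply: le_lt_trans ab.
    exact: (Bconst eta b0 beta).
  have [x xt] := infinite_setN0 theta_inf.
  by exists x => // beta Bb eb; case: nB; exists beta.
move: b_theta; rewrite -otpE ltNge => /negP; apply.
by apply: otp_le_below => _ [beta [Bb eb] <-]; exact: Xb.
Qed.
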